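(* Let $n>2$ be an integer. For integers $0\le r\le s<n$ and $r<k\le n$ set $$P_{n,r,s}(k)=\begin{cases}\dfrac{r(n-k)}{n(n-1)(k-1)}, & r<k<s,\\[2mm] \dfrac{r(s-1)(n-k)}{n(n-1)(k-1)(k-2)}+\dfrac{r(s-1)}{n(n-1)(k-2)}, & k\ge s,\end{cases}$$ and $$E^{PD,C}_n(r,s)=\sum_{k=r+1}^{n}\left(1-\frac{k}{n}\right)P_{n,r,s}(k),$$ where any term whose denominator vanishes is interpreted as $0$. Let $(\mathcal{M}_1(n),\mathcal{M}_2(n))$ be a point at which $E^{PD,C}_n$ attains its maximum. Let $\beta=0.39422\dots$ be the unique solution in $(0,1)$ of $-2+\frac1\beta+\beta+\log\beta=0$, and let $\alpha=0.17248\dots$ be the unique solution in $(0,\beta)$ of $1-\frac1\beta-2\beta-\frac{\beta^2}{2}+4\alpha-\frac{3\alpha^2}{2}-\log\alpha=0$. Then (i) $\lim_{n\to\infty}\mathcal{M}_1(n)/n=\alpha=0.17248\dots$; (ii) $\lim_{n\to\infty}\mathcal{M}_2(n)/n=\beta=0.39422\dots$; (iii) $\lim_{n\to\infty}E^{PD,C}_n(\mathcal{M}_1(n),\mathcal{M}_2(n))=0.11811\dots$ (namely the value $\frac{\alpha}{2}\left(2-6\beta+\beta^2+4\alpha-\alpha^2+2(1+\beta)\log\beta-2\log\alpha\right)$).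
   Context: $E^{PD,C}_n(r,s)$ is the expected payoff, in the Postdoc secretary problem (goal: select the overall second best of $n$ randomly ordered candidates) with payoff $1-k/n$ when the accepted $k$-th candidate is the overall second best, of the two-threshold strategy: reject the first $r$ candidates, then accept the first candidate better than all preceding ones until the $s$-th interview, and thereafter accept the first candidate which is best or second best among those seen so far. *)

(* Defs.v *)
From HB Require Import structures.
From mathcomp Require Import all_boot all_order all_algebra.
From mathcomp Require Import all_classical all_reals all_analysis.
Set Implicit Arguments. Unset Strict Implicit. Unset Printing Implicit Defensive.
Import Order.TTheory GRing.Theory Num.Theory.
Local Open Scope ring_scope.

(* P_{n,r,s}(k); division uses MathComp's convention x / 0 = 0,
   which realizes "any term whose denominator vanishes is 0". *)
Definition postdocP (R : realType) (n r s k : nat) : R :=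
  if (k < s)%N then
    r%:R * (n%:R - k%:R) / (n%:R * (n%:R - 1) * (k%:R - 1))
  else
    r%:R * (s%:R - 1) * (n%:R - k%:R)
      / (n%:R * (n%:R - 1) * (k%:R - 1) * (k%:R - 2))
    + r%:R * (s%:R - 1) / (n%:R * (n%:R - 1) * (k%:R - 2)).

Definition postdocE (R : realType) (n r s : nat) : R :=
  \sum_(r.+1 <= k < n.+1) (1 - k%:R / n%:R) * postdocP R n r s k.

Definition is_postdoc_maximizer (R : realType) (n r s : nat) : Prop :=
  (r <= s < n)%N /\
  forall r' s' : nat, (r' <= s' < n)%N -> postdocE R n r' s' <= postdocE R n r s.

(* Main.v *)
Require Import Defs.
From HB Require Import structures.
From mathcomp Require Import all_boot all_order all_algebra.
From mathcomp Require Import ring lra.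
From mathcomp Require Import all_classical all_reals all_analysis.
Set Implicit Arguments.
Unset Strict Implicit.
Unset Printing Implicit Defensive.
Import Order.TTheory GRing.Theory Num.Theory.
Import numFieldNormedType.Exports.
Local Open Scope ring_scope.
Local Open Scope classical_set_scope.

(* Replacing the sums by integrals, E_n(r, s) differs by O(1/n), uniformly in
   r and s, from F(r/n, s/n) with F(x, y) = x (G(y) - L(x)). On the triangle
   0 <= x <= y <= 1 this F has a unique and well-separated maximum, so that the
   maximizers of E_n are attracted to it. Indeed G increases up to beta and
   decreases afterwards, x |-> F(x, beta) increases up to alpha and decreases on
   [alpha, beta], and for x >= beta the best admissible choice is y = x, where
   F(x, x) is decreasing. The signs of G' and of the derivative of F(x, x)
   follow from the tangent-line inequality for the convex function x ln x. *)

(** * Mean value theorem and tangent-line inequalities *)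

Lemma MVT_pos (R : realType) (f f' : R -> R) (a b : R) :
  0 < a -> a < b -> (forall x : R, 0 < x -> is_derive x 1 f (f' x)) ->
  exists2 c, a < c < b & f b - f a = f' c * (b - a).
Proof.
move=> a0 ab df.
have [x||c cab e] := @MVT R f f' a b ab.
- by rewrite in_itv /= => /andP[ax _]; apply: df; exact: lt_trans ax.
- apply: derivable_within_continuous => x.
  rewrite in_itv /= => /andP[ax _].
  by have /df[] : 0 < x by exact: lt_le_trans ax.
- by exists c => //; move: cab; rewrite in_itv.
Qed.

Lemma ltr_ln_subr1 (R : realType) (t : R) : 0 < t -> t != 1 -> ln t < t - 1.
Proof.
move=> t0 t1; rewrite -ltr_expR lnK ?posrE//.
have := @expR_gt1Dx R (t - 1); rewrite subr_eq0 => /(_ t1).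
by rewrite subrKC.
Qed.

Lemma ler_ln_subr1 (R : realType) (t : R) : 0 < t -> ln t <= t - 1.
Proof. by move=> t0; have := @le_ln1Dx R (t - 1); rewrite subrKC; apply; lra. Qed.

(** Multiplying [ln t <= t - 1] at [t = z / y] by [y] gives this convexity of [x ln x]. *)
Lemma xlnx_ge_tangent (R : realType) (y z : R) : 0 < y -> 0 < z ->
  z * ln z + (ln z + 1) * (y - z) <= y * ln y.
Proof.
move=> y0 z0; have /ler_ln_subr1 : 0 < z / y by exact: divr_gt0.
rewrite ln_div ?posrE// -(ler_pM2l y0).
have -> : y * (z / y - 1) = z - y by field; rewrite gt_eqF.
by lra.
Qed.

(** * The limit function and its derivatives *)

Definition postdoc_G (R : realType) (y : R) : R :=
  ln y - 3 * y + y ^+ 2 / 2 + y * ln y.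
Definition postdoc_L (R : realType) (x : R) : R :=
  ln x - 2 * x + x ^+ 2 / 2 - 1.
Definition postdoc_F (R : realType) (x y : R) : R :=
  x * (postdoc_G y - postdoc_L x).
(* F is the limit of E_n with x = r/n and y = s/n; writing F_y for dF/dy,
   F_y(x, y) = x * q(y) / y, (d/dx) F(x, x) = d(x) and dF/dx(x, b) = h_b(x). *)
Definition postdoc_q (R : realType) (y : R) : R := (1 - y) ^+ 2 + y * ln y.
Definition postdoc_d (R : realType) (x : R) : R := 1 - x + 2 * x * ln x.
Definition postdoc_h (R : realType) (b x : R) : R :=
  postdoc_G b - ln x + 4 * x - 3 * x ^+ 2 / 2.

Lemma is_derive_postdoc_G (R : realType) (x : R) : 0 < x ->
  is_derive x 1 (@postdoc_G R) (postdoc_q x / x).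
Proof.
move=> x0; have := is_derive1_ln x0 => ?.
apply: is_derive_eq; rewrite /postdoc_q /GRing.scale /=; field.
by rewrite gt_eqF.
Qed.

Lemma is_derive_postdoc_F (R : realType) (b x : R) : 0 < x ->
  is_derive x 1 (fun x => postdoc_F x b) (postdoc_h b x).
Proof.
move=> x0; have := is_derive1_ln x0 => ?.
rewrite /postdoc_F /postdoc_L.
apply: is_derive_eq; rewrite /postdoc_h /GRing.scale /=; field.
by rewrite gt_eqF.
Qed.

Lemma postdoc_F_diag (R : realType) (x : R) :
  postdoc_F x x = x * (1 - x + x * ln x).
Proof. by rewrite /postdoc_F /postdoc_G /postdoc_L; field. Qed.

Lemma is_derive_postdoc_diag (R : realType) (x : R) : 0 < x ->
  is_derive x 1 (fun x => postdoc_F x x) (postdoc_d x).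
Proof.
move=> x0; have := is_derive1_ln x0 => ?.
rewrite (_ : (fun _ => _) = fun x => x * (1 - x + x * ln x)); last first.
  by apply/funext => y; rewrite postdoc_F_diag.
apply: is_derive_eq; rewrite /postdoc_d /GRing.scale /=; field.
by rewrite gt_eqF.
Qed.

Lemma is_derive_postdoc_h (R : realType) (b x : R) : 0 < x ->
  is_derive x 1 (postdoc_h b) ((3 * x - 1) * (1 - x) / x).
Proof.
move=> x0; have := is_derive1_ln x0 => ?.
rewrite /postdoc_h.
apply: is_derive_eq; rewrite /GRing.scale /=; field.
by rewrite gt_eqF.
Qed.

(** * Signs of the derivatives *)

(** The square in [postdoc_q] has the exact second-order remainder [(y - z) ^+ 2], and [y ln y] lies
    above its tangent. The coefficient [2 * z - 1 + ln z] is the derivative of [postdoc_q] at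
    [z]. *)
Lemma postdoc_q_ge_tangent (R : realType) (y z : R) : 0 < y -> 0 < z ->
  postdoc_q z + (2 * z - 1 + ln z) * (y - z) + (y - z) ^+ 2 <= postdoc_q y.
Proof.
move=> y0 z0; rewrite /postdoc_q.
rewrite [leLHS](_ : _ = (1 - y) ^+ 2 + (z * ln z + (ln z + 1) * (y - z))).
  by rewrite lerD2l xlnx_ge_tangent.
ring.
Qed.

Lemma postdoc_q1 (R : realType) : postdoc_q (1 : R) = 0.
Proof. by rewrite /postdoc_q ln1; ring. Qed.

(** Multiplying the equation for beta by [b] gives [postdoc_q b]. *)
Lemma postdoc_q_root (R : realType) (b : R) : 0 < b ->
  -2 + b^-1 + b + ln b = 0 -> postdoc_q b = 0.
Proof.
move=> b0 e; rewrite -(mulr0 b) -e /postdoc_q; field.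
by rewrite gt_eqF.
Qed.

(** The zeros at [b] and 1 force a negative slope [c] at [b]; the tangent at [b] is then positive to
    the left of [b]. *)
Lemma postdoc_q_gt0 (R : realType) (b y : R) : 0 < b < 1 -> postdoc_q b = 0 ->
  0 < y -> y < b -> 0 < postdoc_q y.
Proof.
move=> /andP[b0 b1] qb y0 yb.
have := postdoc_q_ge_tangent ltr01 b0; rewrite qb postdoc_q1.
have := postdoc_q_ge_tangent y0 b0; rewrite qb.
move: (2 * b - 1 + ln b) => c h1 h2.
have c0 : c < 0 by nra.
nra.
Qed.

(** If the value at [y] were nonnegative, the tangent at [y] would need a negative slope to stay
    below the zero at 1, and a positive one to stay below the zero at [b]. *)
Lemma postdoc_q_lt0 (R : realType) (b y : R) : 0 < b -> postdoc_q b = 0 ->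
  b < y -> y < 1 -> postdoc_q y < 0.
Proof.
move=> b0 qb yb y1; have y0 : 0 < y by lra.
have := postdoc_q_ge_tangent ltr01 y0; rewrite postdoc_q1.
have := postdoc_q_ge_tangent b0 y0; rewrite qb.
move: (2 * y - 1 + ln y) => c h1 h2.
rewrite ltNge; apply/negP => h3.
have [h|h] := lerP c 0; nra.
Qed.

(** The strict bound [ln (1 / 2) < - 1 / 2] makes [postdoc_q] negative at [1 / 2], while it is
    positive to the left of [b]. *)
Lemma postdoc_root_lt_half (R : realType) (b : R) : 0 < b < 1 ->
  postdoc_q b = 0 -> b < 1 / 2.
Proof.
move=> b01 qb; have /andP[b0 b1] := b01.
have half0 : 0 < 1 / 2 :> R by lra.
have half1 : 1 / 2 != 1 :> R by lra.
have qhalf : postdoc_q (1 / 2 : R) < 0.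
  by have := ltr_ln_subr1 half0 half1; rewrite /postdoc_q; lra.
rewrite ltNge le_eqVlt; apply/negP => /orP[/eqP e|hb].
  by move: qhalf; rewrite e qb ltxx.
by have := postdoc_q_gt0 b01 qb half0 hb; rewrite ltNge ltW.
Qed.

(** Since [b * ln b = - (1 - b) ^+ 2], the value is [(1 - b) * (2 * b - 1)], negative because
    [b < 1 / 2]. *)
Lemma postdoc_d_root_lt0 (R : realType) (b : R) : 0 < b < 1 ->
  postdoc_q b = 0 -> postdoc_d b < 0.
Proof.
move=> b01 qb; have := postdoc_root_lt_half b01 qb.
have /andP[b0 b1] := b01.
by move: qb; rewrite /postdoc_q /postdoc_d -mulrA; move: (b * ln b) => c; nra.
Qed.

(** [postdoc_d] is convex, negative at [b] and zero at 1. The final case split is on the sign of its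
    slope [2 * l + 1] at [z]: a nonnegative value at [z] is refuted at [b] or at 1. *)
Lemma postdoc_d_lt0 (R : realType) (b z : R) : 0 < b < 1 ->
  postdoc_q b = 0 -> b < z -> z < 1 -> postdoc_d z < 0.
Proof.
move=> b01 qb bz z1; have /andP[b0 b1] := b01; have z0 : 0 < z by lra.
have := postdoc_d_root_lt0 b01 qb.
have := xlnx_ge_tangent ltr01 z0; rewrite ln1.
have := xlnx_ge_tangent b0 z0.
rewrite /postdoc_d -!mulrA; move: (b * ln b) (z * ln z) (ln z) => u v l h1 h2 h3.
rewrite ltNge; apply/negP => h4.
have [h|h] := lerP (2 * l + 1) 0; nra.
Qed.

Lemma postdoc_h_incr (R : realType) (b x y : R) : 1 / 3 <= x -> x < y -> y <= 1 ->
  postdoc_h b x < postdoc_h b y.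
Proof.
move=> hx xy hy; have x0 : 0 < x by lra.
have [c /andP[xc cy] e] := MVT_pos x0 xy (@is_derive_postdoc_h R b).
rewrite -subr_gt0 e mulr_gt0 ?divr_gt0 ?mulr_gt0//; lra.
Qed.

Lemma postdoc_h_decr (R : realType) (b x y : R) : 0 < x -> x < y -> y <= 1 / 3 ->
  postdoc_h b y < postdoc_h b x.
Proof.
move=> x0 xy hy.
have [c /andP[xc cy] e] := MVT_pos x0 xy (@is_derive_postdoc_h R b).
rewrite -subr_lt0 e !pmulr_llt0 ?invr_gt0; lra.
Qed.

(** The value is again [(1 - b) * (2 * b - 1)]: it agrees with [postdoc_d b] because F_y vanishes at
    [(b, b)]. *)
Lemma postdoc_h_root (R : realType) (b : R) : 0 < b < 1 -> postdoc_q b = 0 ->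
  postdoc_h b b < 0.
Proof.
move=> b01 qb; have := postdoc_root_lt_half b01 qb; have /andP[b0 b1] := b01.
move: qb; rewrite /postdoc_h /postdoc_G /postdoc_q.
move: (b * ln b) => u; nra.
Qed.

(** If [a > 1 / 3], then [postdoc_h b] would increase from 0 at [a] to a negative value at [b]. So
    [a <= 1 / 3], and the function decreases to 0 on the way to [a]. *)
Lemma postdoc_h_gt0 (R : realType) (a b x : R) : 0 < b < 1 -> postdoc_q b = 0 ->
  a < b -> postdoc_h b a = 0 -> 0 < x -> x < a -> 0 < postdoc_h b x.
Proof.
move=> b01 qb ab ha x0 xa; have hb := postdoc_h_root b01 qb.
have /andP[b0 b1] := b01.
have [a3|a3] := lerP a (1 / 3).
  by rewrite -ha; apply: postdoc_h_decr.
by have := postdoc_h_incr b (ltW a3) ab (ltW b1); lra.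
Qed.

(** Up to [1 / 3] the function decreases from its zero at [a]; beyond, it increases towards a
    negative value at [b]. *)
Lemma postdoc_h_lt0 (R : realType) (a b x : R) : 0 < b < 1 -> postdoc_q b = 0 ->
  0 < a -> postdoc_h b a = 0 -> a < x -> x < b -> postdoc_h b x < 0.
Proof.
move=> b01 qb a0 ha ax xb; have hb := postdoc_h_root b01 qb.
have /andP[b0 b1] := b01.
have [x3|x3] := lerP x (1 / 3).
  by rewrite -ha; apply: postdoc_h_decr.
by apply: lt_trans hb; apply: postdoc_h_incr => //; apply: ltW.
Qed.

(** * Monotonicity of the limit function *)

Lemma postdoc_G_incr (R : realType) (b x y : R) : 0 < b < 1 ->
  postdoc_q b = 0 -> 0 < x -> x < y -> y <= b -> postdoc_G x < postdoc_G y.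
Proof.
move=> b01 qb x0 xy yb.
have [c /andP[xc cy] e] := MVT_pos x0 xy (@is_derive_postdoc_G R).
have c0 : 0 < c by lra.
have qc : 0 < postdoc_q c by apply: (postdoc_q_gt0 b01 qb) => //; lra.
by rewrite -subr_gt0 e mulr_gt0 ?divr_gt0// subr_gt0.
Qed.

Lemma postdoc_G_decr (R : realType) (b x y : R) : 0 < b ->
  postdoc_q b = 0 -> b <= x -> x < y -> y <= 1 -> postdoc_G y < postdoc_G x.
Proof.
move=> b0 qb bx xy y1; have x0 : 0 < x by lra.
have [c /andP[xc cy] e] := MVT_pos x0 xy (@is_derive_postdoc_G R).
have c0 : 0 < c by lra.
have qc : postdoc_q c < 0 by apply: (postdoc_q_lt0 b0 qb) => //; lra.
by rewrite -subr_lt0 e !pmulr_llt0 ?invr_gt0// subr_gt0.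
Qed.

Lemma postdoc_G_max (R : realType) (b y : R) : 0 < b < 1 ->
  postdoc_q b = 0 -> 0 < y <= 1 -> postdoc_G y <= postdoc_G b.
Proof.
move=> b01 qb /andP[y0 y1]; have /andP[b0 b1] := b01.
have [yb|by_|->//] := ltrgtP y b.
- by apply/ltW/(postdoc_G_incr b01 qb).
- by apply/ltW/(postdoc_G_decr b0 qb).
Qed.

Lemma postdoc_F_incr (R : realType) (a b x y : R) : 0 < b < 1 ->
  postdoc_q b = 0 -> a < b -> postdoc_h b a = 0 ->
  0 < x -> x < y -> y <= a -> postdoc_F x b < postdoc_F y b.
Proof.
move=> b01 qb ab ha x0 xy ya.
have [c /andP[xc cy] e] := MVT_pos x0 xy (@is_derive_postdoc_F R b).
have hc : 0 < postdoc_h b c by apply: (postdoc_h_gt0 b01 qb ab ha); lra.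
by rewrite -subr_gt0 e mulr_gt0// subr_gt0.
Qed.

Lemma postdoc_F_decr (R : realType) (a b x y : R) : 0 < b < 1 ->
  postdoc_q b = 0 -> 0 < a -> postdoc_h b a = 0 ->
  a <= x -> x < y -> y <= b -> postdoc_F y b < postdoc_F x b.
Proof.
move=> b01 qb a0 ha ax xy yb; have x0 : 0 < x by lra.
have [c /andP[xc cy] e] := MVT_pos x0 xy (@is_derive_postdoc_F R b).
have hc : postdoc_h b c < 0 by apply: (postdoc_h_lt0 b01 qb a0 ha); lra.
by rewrite -subr_lt0 e pmulr_llt0// subr_gt0.
Qed.

Lemma postdoc_diag_decr (R : realType) (b x : R) : 0 < b < 1 ->
  postdoc_q b = 0 -> b <= x -> x <= 1 -> postdoc_F x x <= postdoc_F b b.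
Proof.
move=> b01 qb; rewrite le_eqVlt => /orP[/eqP ->//|bx x1].
have /andP[b0 b1] := b01.
have [c /andP[xc cy] e] := MVT_pos b0 bx (@is_derive_postdoc_diag R).
have dc : postdoc_d c < 0 by apply: (postdoc_d_lt0 b01 qb); lra.
by apply: ltW; rewrite -subr_lt0 e pmulr_llt0// subr_gt0.
Qed.

(* For x >= beta the best choice of y is y = x, which is no better than
   (beta, beta), hence worse than any (x', beta) with alpha <= x' < beta. *)
Lemma postdoc_F_far (R : realType) (b x y : R) : 0 < b < 1 ->
  postdoc_q b = 0 -> b <= x -> x <= y -> y <= 1 ->
  postdoc_F x y <= postdoc_F b b.
Proof.
move=> b01 qb bx xy y1; have /andP[b0 b1] := b01.
apply: le_trans (postdoc_diag_decr b01 qb bx (le_trans xy y1)).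
rewrite ler_pM2l ?lerD2r; last by lra.
move: xy; rewrite le_eqVlt => /orP[/eqP ->//|xy].
exact/ltW/(postdoc_G_decr b0 qb).
Qed.

(** By [postdoc_q b = 0] the value is [b ^+ 2 * (1 - b)]. It serves to exclude [x = 0] as a
    near-maximizer. *)
Lemma postdoc_F_diag_gt0 (R : realType) (b : R) : 0 < b < 1 ->
  postdoc_q b = 0 -> 0 < postdoc_F b b.
Proof.
move=> /andP[b0 b1] qb; rewrite postdoc_F_diag mulr_gt0//.
by move: qb; rewrite /postdoc_q; nra.
Qed.

(** * The well-separated maximum *)

(** The gap [d] makes uniqueness of the maximum robust: it survives replacing F by a function
    uniformly close to it. Monotonicity yields an explicit [d], so no compactness argument is
    used. *)
Lemma postdoc_F_argmax (R : realType) (a b e : R) : 0 < b < 1 ->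
  postdoc_q b = 0 -> 0 < a < b -> postdoc_h b a = 0 ->
  0 < e -> e < a -> a + e < b -> b + e < 1 ->
  exists2 d, 0 < d & forall x y, 0 <= x -> x <= y -> y <= 1 ->
    postdoc_F a b - d < postdoc_F x y -> `|x - a| < e /\ `|y - b| < e.
Proof.
move=> b01 qb /andP[a0 ab] ha e0 ea abe be; have /andP[b0 b1] := b01.
pose m := postdoc_F a b.
(* The first two entries are the losses at [x = a - e] and [x = a + e] with [y = b]. The last two
   are losses from moving [y] to [b - e] or [b + e], where [a - e] bounds [x] from below. *)
pose d := Num.min (m - postdoc_F (a - e) b) (Num.min (m - postdoc_F (a + e) b)
  (Num.min ((a - e) * (postdoc_G b - postdoc_G (b - e)))
           ((a - e) * (postdoc_G b - postdoc_G (b + e))))).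
have Fl x : 0 < x -> x <= a - e -> postdoc_F x b <= postdoc_F (a - e) b.
  move=> x0; rewrite le_eqVlt => /orP[/eqP ->//|xe].
  by apply/ltW/(postdoc_F_incr b01 qb ab ha) => //; lra.
have Fr x : a + e <= x -> x <= b -> postdoc_F x b <= postdoc_F (a + e) b.
  rewrite le_eqVlt => /orP[/eqP ->//|xe xb].
  by apply/ltW/(postdoc_F_decr b01 qb a0 ha) => //; lra.
have F_le x y : 0 < x -> 0 < y <= 1 -> postdoc_F x y <= postdoc_F x b.
  by move=> x0 y01; rewrite ler_pM2l// lerD2r postdoc_G_max.
have Fm x : 0 < x -> x <= b -> postdoc_F x b <= m.
  move=> x0 xb; have [xa|ax|->//] := ltrgtP x a.
  - exact/ltW/(postdoc_F_incr b01 qb ab ha).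
  - exact/ltW/(postdoc_F_decr b01 qb a0 ha).
exists d => [|x y x0 xy y1].
  rewrite !lt_min !subr_gt0 (postdoc_F_incr b01 qb ab ha)//; try lra.
  rewrite (postdoc_F_decr b01 qb a0 ha)//; try lra.
  rewrite !mulr_gt0 ?subr_gt0//.
  - by apply: (postdoc_G_decr b0 qb) => //; lra.
  - by apply: (postdoc_G_incr b01 qb) => //; lra.
rewrite -/m ltrBlDr -ltrBlDl => dF.
have /and4P[d1 d2 d3 d4] : [&& m - postdoc_F x y < m - postdoc_F (a - e) b,
    m - postdoc_F x y < m - postdoc_F (a + e) b,
    m - postdoc_F x y < (a - e) * (postdoc_G b - postdoc_G (b - e)) &
    m - postdoc_F x y < (a - e) * (postdoc_G b - postdoc_G (b + e))].
  by move: dF; rewrite !lt_min.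
have Fb0 : 0 < postdoc_F b b := postdoc_F_diag_gt0 b01 qb.
have Fbr : postdoc_F b b <= postdoc_F (a + e) b by apply: Fr; lra.
have xb : x < b.
  rewrite ltNge; apply/negP => bx.
  by have := postdoc_F_far b01 qb bx xy y1; lra.
(* F vanishes at [x = 0], but the near-maximal value exceeds F at [(a + e, b)], which is at least F
   at [(b, b)] and hence positive. *)
have xn0 : 0 < x.
  rewrite lt_neqAle x0 andbT; apply/negP => /eqP x0'.
  by move: d2; rewrite -x0' {1}/postdoc_F mul0r; lra.
have y01 : 0 < y <= 1 by rewrite y1 andbT; lra.
have xa : `|x - a| < e.
  rewrite ltr_distl; apply/andP; split; rewrite ltNge; apply/negP => h.
  - by have := Fl x xn0 h; have := F_le x y xn0 y01; lra.
  - by have := Fr x h (ltW xb); have := F_le x y xn0 y01; lra.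
split => //; move: xa; rewrite ltr_distl => /andP[xl xr].
(* The loss in [y] alone is [x * (postdoc_G b - postdoc_G y)], and F at [(x, b)] is at most [m]. *)
have gap z : 0 < z <= 1 -> postdoc_G y <= postdoc_G z ->
    (a - e) * (postdoc_G b - postdoc_G z) <= m - postdoc_F x y.
  move=> /(postdoc_G_max b01 qb) zb yz; have Fxb := Fm x xn0 (ltW xb).
  apply: (@le_trans _ _ (x * (postdoc_G b - postdoc_G y))).
    by rewrite ler_pM//; lra.
  by move: Fxb; rewrite /postdoc_F; lra.
rewrite ltr_distl; apply/andP; split; rewrite ltNge; apply/negP => h.
- have : (a - e) * (postdoc_G b - postdoc_G (b - e)) <= m - postdoc_F x y.
    apply: gap; first by lra.
    move: h; rewrite le_eqVlt => /orP[/eqP ->//|h].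
    by apply/ltW/(postdoc_G_incr b01 qb) => //; lra.
  by lra.
- have : (a - e) * (postdoc_G b - postdoc_G (b + e)) <= m - postdoc_F x y.
    apply: gap; first by lra.
    move: h; rewrite le_eqVlt => /orP[/eqP <-//|h].
    by apply/ltW/(postdoc_G_decr b0 qb) => //; lra.
  by lra.
Qed.

(** * Uniform comparison of the sum with the limit function *)

Lemma ln_succ_bounds (R : realType) (y : R) : 0 < y ->
  (y + 1)^-1 <= ln (y + 1) - ln y <= y^-1.
Proof.
move=> y0; have y1 : 0 < y + 1 by lra.
have q1 : 0 < y / (y + 1) by exact: divr_gt0.
have q2 : 0 < (y + 1) / y by exact: divr_gt0.
have := ler_ln_subr1 q1; have := ler_ln_subr1 q2.
rewrite !ln_div ?posrE//.
have -> : (y + 1) / y - 1 = y^-1 by field; rewrite gt_eqF.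
have -> : y / (y + 1) - 1 = - (y + 1)^-1 by field; rewrite gt_eqF.
by move=> ? ?; apply/andP; split; lra.
Qed.

(** Here [j] is [k - 1] and [l] stands for [ln (j + 1) - ln j], of which only the bounds matter. The
    term [p1] is the error of [l] against [j^-1]; the other three are of order [1 / n ^+ 2]. *)
Lemma record_term_error (R : realType) (n r j l : R) :
  1 <= r -> r <= j -> j + 1 <= n -> (j + 1)^-1 <= l <= j^-1 ->
  `|(1 - (j + 1) / n) * (r * (n - (j + 1)) / (n * (n - 1) * j))
    - r / n * (l - 2 / n + (2 * j + 1) / (2 * n ^+ 2))|
  <= 2 * (r / (n * (j * (j + 1))) + (n ^+ 2)^-1).
Proof.
move=> r1 rj jn /andP[l1 l2].
have j0 : 0 < j by lra. have n0 : 0 < n by lra. have n1 : 0 < n - 1 by lra.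
have j1 : 0 < j + 1 by lra.
pose w := r / (n * (j * (j + 1))); rewrite -/w.
pose v := (n ^+ 2)^-1; rewrite -/v.
have v0 : 0 < v by rewrite invr_gt0 exprn_gt0.
set p1 := r / n * (j^-1 - l).
set p2 := r / j * v.
set p3 := r / n * (j / (n - 1)) * v.
set p4 := r / n * (v / 2).
rewrite (_ : _ - _ = p1 - p2 + p3 - p4); last first.
  by rewrite /p1 /p2 /p3 /p4 /v; field; rewrite !gt_eqF.
have rn0 : 0 <= r / n by rewrite divr_ge0//; lra.
have rn1 : r / n <= 1 by rewrite ler_pdivrMr//; lra.
have rj0 : 0 <= r / j by rewrite divr_ge0//; lra.
have rj1 : r / j <= 1 by rewrite ler_pdivrMr//; lra.
have jn0 : 0 <= j / (n - 1) by rewrite divr_ge0//; lra.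
have jn1 : j / (n - 1) <= 1 by rewrite ler_pdivrMr//; lra.
have h1 : 0 <= p1 by rewrite mulr_ge0//; lra.
have h1' : p1 <= w.
  rewrite (_ : w = r / n * (j^-1 - (j + 1)^-1)); last first.
    by rewrite /w; field; rewrite !gt_eqF.
  by rewrite ler_wpM2l//; lra.
have h2 : 0 <= p2 by rewrite mulr_ge0//; lra.
have h2' : p2 <= v by rewrite /p2 ler_piMl//; lra.
have h3 : 0 <= p3 by rewrite mulr_ge0 ?(ltW v0)// mulr_ge0.
have h3' : p3 <= v by rewrite /p3 ler_piMl ?(ltW v0)// mulr_ile1.
have h4 : 0 <= p4 by rewrite mulr_ge0//; lra.
have h4' : p4 <= v / 2 by rewrite /p4 ler_piMl//; lra.
rewrite ler_norml; apply/andP; split; lra.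
Qed.

Lemma second_best_term_error (R : realType) (n r s j l : R) :
  1 <= r -> r <= s -> s <= j -> 2 <= j -> j + 1 <= n ->
  (j + 1)^-1 <= l <= j^-1 ->
  `|(1 - (j + 1) / n) *
      (r * (s - 1) * (n - (j + 1)) / (n * (n - 1) * j * (j - 1))
       + r * (s - 1) / (n * (n - 1) * (j - 1)))
    - r / n * (s / n) * (n / j - n / (j + 1) - l)|
  <= 4 * (r / (n * (j * (j + 1)))).
Proof.
move=> r1 rs sj j2 jn /andP[l1 l2].
have j0 : 0 < j by lra. have n0 : 0 < n by lra. have n1 : 0 < n - 1 by lra.
have j1 : 0 < j + 1 by lra. have jm : 0 < j - 1 by lra.
pose w := r / (n * (j * (j + 1))); rewrite -/w.
have w0 : 0 < w by rewrite divr_gt0 ?mulr_gt0//; lra.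
have nj0 : 0 <= (n - 1 - j) / n by rewrite divr_ge0//; lra.
have nj1 : (n - 1 - j) / n <= 1 by rewrite ler_pdivrMr//; lra.
set p1 := w * (2 * (s / (j - 1)) * ((n - 1 - j) / n)).
set p2 := w * ((j + 1) / (j - 1) * ((n - 1 - j) / n)).
set p3 := r / n * (s / n) * (j^-1 - l).
rewrite (_ : _ - _ = p1 - p2 - p3); last first.
  by rewrite /p1 /p2 /p3 /w; field; rewrite !gt_eqF.
have a0 : 0 <= s / (j - 1) by rewrite divr_ge0//; lra.
have a1 : s / (j - 1) <= 2 by rewrite ler_pdivrMr//; lra.
have b0 : 0 <= (j + 1) / (j - 1) by rewrite divr_ge0//; lra.
have b1 : (j + 1) / (j - 1) <= 3 by rewrite ler_pdivrMr//; lra.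
have h1 : 0 <= p1 by rewrite (mulr_ge0 (ltW w0))// mulr_ge0//; lra.
have h1' : p1 <= w * 4.
  rewrite (ler_wpM2l (ltW w0))// -[leRHS]mulr1 ler_pM//; lra.
have h2 : 0 <= p2 by rewrite (mulr_ge0 (ltW w0))// mulr_ge0.
have h2' : p2 <= w * 3.
  by rewrite (ler_wpM2l (ltW w0))// -[leRHS]mulr1 ler_pM.
have h3 : 0 <= p3 by rewrite !mulr_ge0 ?invr_ge0//; lra.
have h3' : p3 <= w.
  rewrite (_ : w = r / n * (j^-1 - (j + 1)^-1)); last first.
    by rewrite /w; field; rewrite !gt_eqF.
  rewrite /p3 -mulrA ler_wpM2l//; first by rewrite divr_ge0//; lra.
  have c0 : 0 <= s / n by rewrite divr_ge0//; lra.
  have c1 : s / n <= 1 by rewrite ler_pdivrMr//; lra.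
  by rewrite -[leRHS]mul1r ler_pM//; lra.
rewrite ler_norml; apply/andP; split; lra.
Qed.

(** This is the case [k = s]: the summand already has its second form, while the primitive still
    moves by its record part. The bound is crude, but it is needed only once per sum. *)
Lemma switch_term_error (R : realType) (n r j l : R) :
  1 <= r -> r <= j -> j + 1 <= n -> j = 1 \/ 2 <= j ->
  (j + 1)^-1 <= l <= j^-1 ->
  `|(1 - (j + 1) / n) *
      (r * j * (n - (j + 1)) / (n * (n - 1) * j * (j - 1))
       + r * j / (n * (n - 1) * (j - 1)))
    - r / n * (l - 2 / n + (2 * j + 1) / (2 * n ^+ 2))| <= 4 / n.
Proof.
move=> r1 rj jn j12 /andP[l1 l2].
have j0 : 0 < j by lra. have n0 : 0 < n by lra. have n1 : 0 < n - 1 by lra.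
have j1 : 0 < j + 1 by lra.
set T := (X in `|X - _|).
have vn0 : 0 < n^-1 by rewrite invr_gt0.
have T02 : 0 <= T <= 2 / n.
  (* For [j = 1] the denominators contain [j - 1 = 0], so [T] is 0 by the convention on division. *)
  have [je|j2] := j12.
    rewrite /T je subrr !mulr0 invr0 !mulr0 addr0 mulr0 lexx/=.
    by rewrite divr_ge0//; lra.
  have jm : 0 < j - 1 by lra.
  rewrite (_ : T = r / (j - 1) * ((n - 1 - j) / n) / n); last first.
    by rewrite /T; field; rewrite !gt_eqF.
  have a0 : 0 <= r / (j - 1) by rewrite divr_ge0//; lra.
  have a1 : r / (j - 1) <= 2 by rewrite ler_pdivrMr//; lra.
  have nj0 : 0 <= (n - 1 - j) / n by rewrite divr_ge0//; lra.
  have nj1 : (n - 1 - j) / n <= 1 by rewrite ler_pdivrMr//; lra.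
  apply/andP; split; first by rewrite divr_ge0 ?(ltW n0)// mulr_ge0.
  rewrite (ler_pM2r vn0) -[leRHS]mulr1.
  exact: ler_pM.
set p1 := r * l / n.
set p2 := r / n * (2 / n).
set p3 := r / n * ((2 * j + 1) / (2 * n) / n).
rewrite (_ : r / n * _ = p1 - p2 + p3); last first.
  by rewrite /p1 /p2 /p3; field; rewrite !gt_eqF.
have rn0 : 0 <= r / n by rewrite divr_ge0//; lra.
have rn1 : r / n <= 1 by rewrite ler_pdivrMr//; lra.
have l0 : 0 <= l by apply: le_trans l1; rewrite invr_ge0 ltW.
have h1 : 0 <= p1 by rewrite divr_ge0// ?mulr_ge0//; lra.
have h1' : p1 <= n^-1.
  rewrite ler_piMl//; first by lra.
  apply: (@le_trans _ _ (r * j^-1)); first by rewrite ler_wpM2l//; lra.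
  by rewrite ler_pdivrMr//; lra.
have h2 : 0 <= p2 by rewrite mulr_ge0//; lra.
have h2' : p2 <= 2 / n by rewrite ler_piMl//; lra.
have c0 : 0 <= (2 * j + 1) / (2 * n) by rewrite divr_ge0//; lra.
have c1 : (2 * j + 1) / (2 * n) <= 1 by rewrite ler_pdivrMr//; lra.
have h3 : 0 <= p3 by rewrite mulr_ge0// mulr_ge0// ltW.
have h3' : p3 <= n^-1.
  rewrite /p3 mulrA ler_piMl ?(ltW vn0)//.
  by rewrite mulr_ile1.
by move: T02 => /andP[? ?]; rewrite ler_norml; apply/andP; split; lra.
Qed.

(* Primitives of the limits (1 - t)^2 / t and (1 - t) / t^2 of the summands
   with k < s and with k >= s, up to the factors x and x * y. *)
Definition record_primitive (R : realType) (t : R) : R :=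
  ln t - 2 * t + t ^+ 2 / 2.
Definition second_best_primitive (R : realType) (t : R) : R := - t^-1 - ln t.

(** [minn] and [maxn] freeze one of the two terms on either side of [s], so a single expression
    telescopes over all [k]. *)
Definition postdoc_primitive (R : realType) (n r s k : nat) : R :=
  r%:R / n%:R * record_primitive ((minn k s)%:R / n%:R)
  + r%:R / n%:R * (s%:R / n%:R) * second_best_primitive ((maxn k s)%:R / n%:R).

(* Its increments bound the errors of the summands of E_n, see
   [postdoc_error_step], and add up to at most 12 / n. *)
Definition postdoc_error (R : realType) (n r s k : nat) : R :=
  4 * (- (r%:R / n%:R / k%:R) + k%:R * (n%:R ^+ 2)^-1 + (s <= k)%N%:R / n%:R).

Lemma record_primitive_step (R : realType) (n j : nat) :
  (0 < n)%N -> (0 < j)%N ->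
  record_primitive (j.+1%:R / n%:R) - record_primitive (j%:R / n%:R)
  = (ln (j%:R + 1) - ln j%:R) - 2 / n%:R
    + (2 * j%:R + 1) / (2 * n%:R ^+ 2) :> R.
Proof.
move=> n0 j0; rewrite /record_primitive !ln_div ?posrE ?ltr0n// -natr1.
by field; rewrite pnatr_eq0 -lt0n.
Qed.

Lemma second_best_primitive_step (R : realType) (n j : nat) :
  (0 < n)%N -> (0 < j)%N ->
  second_best_primitive (j.+1%:R / n%:R) - second_best_primitive (j%:R / n%:R)
  = n%:R / j%:R - n%:R / (j%:R + 1) - (ln (j%:R + 1) - ln j%:R) :> R.
Proof.
move=> n0 j0; rewrite /second_best_primitive !ln_div ?posrE ?ltr0n// -natr1.
by rewrite !invf_div; ring.
Qed.

Lemma postdoc_error_step (R : realType) (n r s j : nat) :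
  (0 < n)%N -> (0 < j)%N ->
  postdoc_error R n r s j.+1 - postdoc_error R n r s j
  = 4 * (r%:R / (n%:R * (j%:R * (j%:R + 1))) + (n%:R ^+ 2)^-1
         + (j.+1 == s)%N%:R / n%:R).
Proof.
move=> n0 j0; rewrite /postdoc_error.
have -> : (s <= j.+1)%N%:R = (s <= j)%N%:R + (j.+1 == s)%N%:R :> R.
  rewrite -natrD; congr _%:R; have [sj|js] := leqP s j.
    by rewrite leqW// gtn_eqF// ltnS.
  by rewrite eqn_leq js.
rewrite -natr1; field.
by rewrite natr1 !pnatr_eq0 -!lt0n n0 j0.
Qed.

Lemma postdoc_term_error (R : realType) (n r s j : nat) :
  (0 < r <= s)%N -> (r <= j < n)%N ->
  `|(1 - j.+1%:R / n%:R) * postdocP R n r s j.+1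
    - (postdoc_primitive R n r s j.+1 - postdoc_primitive R n r s j)|
  <= postdoc_error R n r s j.+1 - postdoc_error R n r s j.
Proof.
move=> /andP[r0 rs] /andP[rj jn].
have j0 : (0 < j)%N by exact: leq_trans rj.
have n0 : (0 < n)%N by exact: leq_trans jn.
rewrite postdoc_error_step//.
have Hr : 1 <= r%:R :> R by rewrite ler1n.
have Hrj : r%:R <= j%:R :> R by rewrite ler_nat.
have Hrs : r%:R <= s%:R :> R by rewrite ler_nat.
have Hjn : j%:R + 1 <= n%:R :> R by rewrite natr1 ler_nat.
have n0' : 0 < n%:R :> R by rewrite ltr0n.
have j0' : 0 < j%:R :> R by rewrite ltr0n.
have Hl := ln_succ_bounds j0'.
have v0 : 0 < (n%:R ^+ 2)^-1 :> R by rewrite invr_gt0 exprn_gt0.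
have vn0 : 0 < n%:R^-1 :> R by rewrite invr_gt0.
have w0 : 0 < r%:R / (n%:R * (j%:R * (j%:R + 1))) :> R.
  by rewrite divr_gt0 ?mulr_gt0//; lra.
rewrite /postdoc_primitive /postdocP -natr1 (addrK 1).
have -> : j%:R + 1 - 2 = j%:R - 1 :> R by ring.
have [sj|] := boolP (s <= j)%N; last first.
  rewrite -ltnNge => js.
  rewrite (minn_idPl js) (minn_idPl (ltnW js)).
  rewrite (maxn_idPr js) (maxn_idPr (ltnW js)).
  rewrite (_ : forall a b c : R, a + c - (b + c) = a - b) -?mulrBr; last first.
    by move=> *; ring.
  rewrite record_primitive_step//.
  have [js'|sj'|e] := ltngtP j.+1 s.
  - rewrite mul0r addr0.
    by apply: le_trans (record_term_error Hr Hrj Hjn Hl) _; lra.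
  - by move: js; rewrite ltnNge -ltnS sj'.
  - rewrite -e -natr1 (addrK 1).
    have Hj12 : j%:R = 1 :> R \/ 2 <= j%:R :> R.
      have [j2|] := leqP 2 j; first by right; rewrite ler_nat.
      rewrite ltnS => j1; left.
      by have -> : j = 1%N by apply/eqP; rewrite eqn_leq j1.
    by apply: le_trans (switch_term_error Hr Hrj Hjn Hj12 Hl) _; rewrite mulr1n; lra.
rewrite ltnNge leqW//= gtn_eqF ?ltnS//= (minn_idPr sj) (minn_idPr (leqW sj)).
rewrite (maxn_idPl sj) (maxn_idPl (leqW sj)).
rewrite (_ : forall a b c : R, c + a - (c + b) = a - b) -?mulrBr; last first.
  by move=> *; ring.
rewrite second_best_primitive_step//.
(* For [j = 1] all of [r], [s], [j] equal 1 and the summand is 0, so the increment of the primitive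
   is bounded directly. *)
have [j1|j2] := leqP j 1.
  have je : j = 1%N by apply/eqP; rewrite eqn_leq j1.
  have se : s = 1%N by apply/eqP; rewrite eqn_leq -{1}je sj (leq_trans r0).
  have re : r = 1%N by apply/eqP; rewrite eqn_leq r0 -{1}se rs.
  move: Hl w0; rewrite je se re => /andP[l1 l2] w0.
  set T := (X in X - _); have -> : T = 0.
    by rewrite /T subrr !(mulr0, mul0r) addr0 mulr0.
  move: l1 l2; rewrite invr1; set l := ln _ - _ => l1 l2.
  have l0 : 0 <= l by apply: le_trans l1; rewrite invr_ge0.
  rewrite (_ : 0 - _ = (n%:R ^+ 2)^-1 * l - n%:R^-1 / 2); last first.
    by field; rewrite gt_eqF.
  rewrite (_ : 1 / _ = n%:R^-1 / 2); last by field; rewrite gt_eqF.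
  have h0 : 0 <= (n%:R ^+ 2)^-1 * l by rewrite mulr_ge0// ltW.
  have h1 : (n%:R ^+ 2)^-1 * l <= (n%:R ^+ 2)^-1 by rewrite ler_piMr// ltW.
  by rewrite ler_norml; apply/andP; split; lra.
have Hsj : s%:R <= j%:R :> R by rewrite ler_nat.
have Hj2 : 2 <= j%:R :> R by rewrite ler_nat.
by apply: le_trans (second_best_term_error Hr Hrs Hsj Hj2 Hjn Hl) _; lra.
Qed.

(** Every summand has the factor [r]. This settles the case [r = 0], which the summand estimates
    exclude. *)
Lemma postdocE_r0 (R : realType) (n s : nat) : postdocE R n 0 s = 0.
Proof.
rewrite /postdocE big1// => k _; rewrite /postdocP.
by case: ifP => _; rewrite !mul0r ?addr0 mulr0.
Qed.

(* Summing [postdoc_term_error] telescopes on both sides. *)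
Lemma postdocE_approx (R : realType) (n r s : nat) : (r <= s < n)%N ->
  `|postdocE R n r s - postdoc_F (r%:R / n%:R) (s%:R / n%:R)| <= 12 / n%:R.
Proof.
case: (posnP r) => [->|r0] /andP[rs sn].
  by rewrite postdocE_r0 /postdoc_F !mul0r subrr normr0 divr_ge0.
have n0 : (0 < n)%N by exact: leq_ltn_trans sn.
have rn : (r <= n)%N by rewrite ltnW// (leq_ltn_trans rs).
have n0' : 0 < n%:R :> R by rewrite ltr0n.
have r0' : 0 < r%:R :> R by rewrite ltr0n.
have s0' : 0 < s%:R :> R by rewrite ltr0n (leq_trans r0).
(* The identity is exact. The second-best part contributes [x * (1 - y + y * ln y)], whence the
   constant [- 1] in [postdoc_L] and the extra terms of [postdoc_G]. *)
have FE : postdoc_F (r%:R / n%:R) (s%:R / n%:R)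
    = postdoc_primitive R n r s n - postdoc_primitive R n r s r.
  rewrite /postdoc_primitive (minn_idPr (ltnW sn)) (maxn_idPl (ltnW sn)).
  rewrite (minn_idPl rs) (maxn_idPr rs) divff ?gt_eqF//.
  rewrite /postdoc_F /postdoc_G /postdoc_L /record_primitive.
  rewrite /second_best_primitive ln1.
  by field; rewrite !gt_eqF.
rewrite FE -telescope_sumr// /postdocE big_add1 /= -sumrB.
apply: le_trans (ler_norm_sum _ _ _) _.
apply: (@le_trans _ _ (\sum_(r <= j < n)
    (postdoc_error R n r s j.+1 - postdoc_error R n r s j))).
  rewrite big_nat [leRHS]big_nat; apply: ler_sum => j rjn.
  by apply: postdoc_term_error; rewrite ?r0.
rewrite telescope_sumr// /postdoc_error (ltnW sn).
(* Three contributions [n^-1] remain, one from each term of [postdoc_error]; the factor 4 makes them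
   [12 / n]. All else has a favourable sign. *)
have -> : r%:R / n%:R / r%:R = n%:R^-1 :> R by field; rewrite !gt_eqF.
have -> : n%:R * (n%:R ^+ 2)^-1 = n%:R^-1 :> R by field; rewrite !gt_eqF.
have h1 : 0 <= r%:R / n%:R / n%:R :> R by rewrite !divr_ge0.
have h2 : 0 <= r%:R * (n%:R ^+ 2)^-1 :> R by rewrite divr_ge0.
have h3 : 0 <= (s <= r)%N%:R / n%:R :> R by rewrite divr_ge0.
by rewrite mulr1n; lra.
Qed.

(** * Limits of sequences *)

Lemma cvg_div_natr (R : realType) (c : R) : (fun n => c / n%:R) @ \oo --> 0.
Proof.
apply/cvgrPdist_lt => e e0; near=> n.
have n0 : 0 < n%:R :> R by rewrite ltr0n; near: n; exact: nbhs_infty_gt.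
rewrite sub0r normrN normrM normfV (ger0_norm (ltW n0)) ltr_pdivrMr//.
rewrite mulrC -ltr_pdivrMr//; near: n; exact: nbhs_infty_gtr.
Unshelve. all: by end_near. Qed.

Lemma cvg_dist_div_natr (R : realType) (c : R) (u v : nat -> R) (l : R) :
  (\forall n \near \oo, `|u n - v n| <= c / n%:R) ->
  v @ \oo --> l -> u @ \oo --> l.
Proof.
move=> uv vl; have uv0 : (fun n => u n - v n) @ \oo --> 0.
  apply/norm_cvg0P; apply: (squeeze_cvgr _ (cvg_cst 0) (cvg_div_natr c)).
  by apply: filterS uv => n ->; rewrite normr_ge0.
rewrite -(add0r l) (_ : u = (fun n => u n - v n) + v); first exact: cvgD.
by apply/funext => n /=; rewrite fctE subrK.
Qed.

Lemma cvg_truncn_div (R : realType) (a : R) : 0 <= a ->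
  (fun n => (Num.trunc (a * n%:R))%:R / n%:R) @ \oo --> a.
Proof.
move=> a0; apply: (@cvg_dist_div_natr _ 1 _ _ _ _ (cvg_cst a)).
near=> n; have n0 : 0 < n%:R :> R.
  by rewrite ltr0n; near: n; exact: nbhs_infty_gt.
have /truncn_itv : 0 <= a * n%:R by rewrite mulr_ge0.
move: (Num.trunc _) => k /andP[ka]; rewrite -natr1 => ak.
have -> : k%:R / n%:R - a = (k%:R - a * n%:R) / n%:R by field; rewrite gt_eqF.
rewrite normrM normfV (gtr0_norm n0) ler_pM2r ?invr_gt0// ler_norml.
by apply/andP; split; lra.
Unshelve. all: by end_near. Qed.

Lemma cvg_postdoc_F (R : realType) (u v : nat -> R) (a b : R) : 0 < a -> 0 < b ->
  u @ \oo --> a -> v @ \oo --> b ->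
  (fun n => postdoc_F (u n) (v n)) @ \oo --> postdoc_F a b.
Proof.
move=> a0 b0 ua vb.
have lna : (fun n => ln (u n)) @ \oo --> ln a.
  exact: (continuous_cvg _ (continuous_ln a0) ua).
have lnb : (fun n => ln (v n)) @ \oo --> ln b.
  exact: (continuous_cvg _ (continuous_ln b0) vb).
rewrite /postdoc_F /postdoc_G /postdoc_L.
apply: cvgM => //; apply: cvgB.
- apply: cvgD; last exact: cvgM.
  apply: cvgD; last by apply: cvgM; [exact: cvgM|exact: cvg_cst].
  by apply: cvgB => //; apply: cvgM => //; exact: cvg_cst.
- apply: cvgB; last exact: cvg_cst.
  apply: cvgD; last by apply: cvgM; [exact: cvgM|exact: cvg_cst].
  by apply: cvgB => //; apply: cvgM => //; exact: cvg_cst.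
Qed.

(** [postdoc_h b a] is the left side of the equation for alpha plus [1 + b] times that of the
    equation for beta. *)
Lemma postdoc_h_eq0 (R : realType) (a b : R) : 0 < b ->
  -2 + b^-1 + b + ln b = 0 ->
  1 - b^-1 - 2 * b - b ^+ 2 / 2 + 4 * a - 3 * a ^+ 2 / 2 - ln a = 0 ->
  postdoc_h b a = 0.
Proof.
move=> b0 eb ea; rewrite -(addr0 0) -{1}ea -{1}(mulr0 (1 + b)) -eb.
by rewrite /postdoc_h /postdoc_G; field; rewrite gt_eqF.
Qed.

Theorem theorem9 (R : realType) (M1 M2 : nat -> nat) (alpha beta : R) :
  (forall n : nat, (2 < n)%N -> is_postdoc_maximizer R n (M1 n) (M2 n)) ->
  0 < beta < 1 ->
  -2 + beta^-1 + beta + ln beta = 0 ->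
  0 < alpha < beta ->
  1 - beta^-1 - 2 * beta - beta ^+ 2 / 2 + 4 * alpha - 3 * alpha ^+ 2 / 2
    - ln alpha = 0 ->
  [/\ (fun n : nat => (M1 n)%:R / n%:R : R) @ \oo --> alpha,
      (fun n : nat => (M2 n)%:R / n%:R : R) @ \oo --> beta &
      (fun n : nat => postdocE R n (M1 n) (M2 n)) @ \oo -->
        alpha / 2 * (2 - 6 * beta + beta ^+ 2 + 4 * alpha - alpha ^+ 2
                     + 2 * (1 + beta) * ln beta - 2 * ln alpha)].
Proof.
move=> Mmax b01 eb a0b ea.
have /andP[b0 b1] := b01; have /andP[a0 ab] := a0b.
have qb := postdoc_q_root b0 eb.
have ha := postdoc_h_eq0 b0 eb ea.
(* The pair [(A n, B n)] is an admissible competitor whose rescaled F-value tends to the maximum of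
   F. *)
pose A n := Num.trunc (alpha * n%:R); pose B n := Num.trunc (beta * n%:R).
have AB n : (0 < n)%N -> (A n <= B n < n)%N.
  move=> n0; have n0' : 0 < n%:R :> R by rewrite ltr0n.
  have an0 : 0 <= alpha * n%:R by rewrite mulr_ge0// ltW.
  have bn0 : 0 <= beta * n%:R by rewrite mulr_ge0// ltW.
  rewrite /A /B truncn_ge_nat// truncn_lt_nat// gtr_pMl// b1 andbT.
  apply: (@le_trans _ _ (alpha * n%:R)); first by rewrite truncn_le.
  by rewrite ler_pM2r// ltW.
have FAB := cvg_postdoc_F a0 b0
  (cvg_truncn_div (ltW a0)) (cvg_truncn_div (ltW b0)).
have near_argmax (e : R) : 0 < e ->
    \forall n \near \oo, `|(M1 n)%:R / n%:R - alpha| < e /\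
                         `|(M2 n)%:R / n%:R - beta| < e.
  (* Shrinking [e] to [c] keeps the square around [(alpha, beta)] inside the range that
     [postdoc_F_argmax] requires. *)
  move=> e0; pose c := Num.min e (Num.min (alpha / 2)
    (Num.min ((beta - alpha) / 2) ((1 - beta) / 2))).
  have c0 : 0 < c by rewrite !lt_min e0 !divr_gt0//; lra.
  have : [&& c <= e, c <= alpha / 2, c <= (beta - alpha) / 2 &
             c <= (1 - beta) / 2].
    by have := lexx c; rewrite {2}/c !le_min.
  move=> /and4P[ce c1 c2 c3].
  have [||| d d0 dP] := postdoc_F_argmax b01 qb a0b ha c0; try lra.
  near=> n.
  have n2 : (2 < n)%N by near: n; exact: nbhs_infty_gt.
  have n0 : (0 < n)%N by exact: leq_trans n2.
  have n0' : 0 < n%:R :> R by rewrite ltr0n.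
  have [/[dup] M12 /andP[M12l M12r] Mge] := Mmax n n2.
  have [] := dP ((M1 n)%:R / n%:R) ((M2 n)%:R / n%:R).
  - by rewrite divr_ge0.
  - by rewrite ler_pM2r ?invr_gt0// ler_nat.
  - by rewrite ler_pdivrMr// mul1r ler_nat ltnW.
  - have := postdocE_approx R M12; have := postdocE_approx R (AB n n0).
    have := Mge _ _ (AB n n0).
    (* Two errors of [12 / n] occur, at the maximizer and at [(A n, B n)]. They use half of [d]; the
       convergence of F along the competitors uses the other half. *)
    have h24 : 24 / n%:R < d / 2.
      rewrite ltr_pdivrMr// mulrC -ltr_pdivrMr; last by lra.
      by near: n; exact: nbhs_infty_gtr.
    have : `|postdoc_F alpha beta - postdoc_F ((A n)%:R / n%:R) ((B n)%:R / n%:R)|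
        < d / 2.
      by near: n; move/cvgrPdist_lt: FAB; apply; lra.
    rewrite ltr_norml !ler_norml => /andP[? ?] ? /andP[? ?] /andP[? ?].
    by lra.
  by move=> h1 h2; split; [exact: lt_le_trans h1 ce|exact: lt_le_trans h2 ce].
have c1 : (fun n : nat => (M1 n)%:R / n%:R : R) @ \oo --> alpha.
  apply/cvgrPdist_lt => e e0; apply: filterS (near_argmax e e0) => n [+ _].
  by rewrite distrC.
have c2 : (fun n : nat => (M2 n)%:R / n%:R : R) @ \oo --> beta.
  apply/cvgrPdist_lt => e e0; apply: filterS (near_argmax e e0) => n [_ +].
  by rewrite distrC.
split => //.
(* The closed form is F at [(alpha, beta)], identically in both variables. *)
rewrite [X in _ --> X](_ : _ = postdoc_F alpha beta); last first.
  by rewrite /postdoc_F /postdoc_G /postdoc_L; field.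
apply: (@cvg_dist_div_natr _ 12 _ _ _ _ (cvg_postdoc_F a0 b0 c1 c2)).
near=> n; apply: postdocE_approx.
have n2 : (2 < n)%N by near: n; exact: nbhs_infty_gt.
by case: (Mmax n n2).
Unshelve. all: by end_near. Qed.
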